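(* In the Ising mixed $p$-spin model with parameters $(\xi,h)$, $\xi$ convex on $[-1,1]$, let $Q_N$ be, for each $N$, a (random) nearest-neighbor Markov transition matrix on $\Sigma_N$ satisfying detailed balance with respect to the Gibbs measure $\pi_N$, and let $\lambda_1$ be the spectral gap of $I-Q_N$. Then $$\limsup_{N\to\infty}\frac1N\log\lambda_1\le-\mathcal H$$ almost surely. In particular, if Generalized FEB holds, this is strictly negative.
   Context: **Model.** For $N\ge1$ let $\Sigma_N=\{-1,1\}^N$ and let $d\sigma$ be the uniform probability measure on $\Sigma_N$. Let $\xi(t)=\sum_{p\ge1}\beta_p^2t^p$ with $\xi(1+\epsilon)<\infty$ for some $\epsilon>0$, and $h\ge0$. $H_N$ is the Gaussian process on $\Sigma_N$ with $\mathbb{E}H_N(\sigma)=h\sum_i\sigma_i$ and $\mathrm{Cov}(H_N(\sigma^1),H_N(\sigma^2))=N\xi(R_{12})$, where $R_{12}=\frac1N\sum_i\sigma^1_i\sigma^2_i$; all $H_N$ live on one probability space. The Gibbs measure is $\pi_N(d\sigma)=e^{-H_N(\sigma)}d\sigma/Z_N$. **Dynamics.** $Q_N$ may depend on $H_N$. Detailed balance: $\pi_N(\sigma^1)Q(\sigma^1,\sigma^2)=\pi_N(\sigma^2)Q(\sigma^2,\sigma^1)$. Nearest-neighbor: $Q(x,y)=0$ if $x,y$ differ in more than one coordinate. $\lambda_1=\min_{\mathrm{Var}_{\pi_N}(f)\ne0}\langle (I-Q)f,f\rangle_{L^2(\pi_N)}/\mathrm{Var}_{\pi_N}(f)$; $\log0=-\infty$.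 **Generalized FEB.** Let $\mathcal H=\sup_{-1\le q_1<q_2<q_3\le1}\big(-I(q_1)+I(q_2)-I(q_3)\big)$. Generalized FEB holds if $\mathcal H>0$. Here $I:[-1,1]\to[0,\infty]$ is the rate function of the almost sure large deviation principle with speed $N$ for $\mathscr Q_N(\cdot)=\pi_N^{\otimes2}(R_{12}\in\cdot)$, given by $$I(q)=-\inf_{\lambda\in\mathbb R,\ Q\in\mathcal Q_q,\ \nu\in\Pr([0,1])}P(\nu,Q,\lambda)+2\min_{\nu\in\Pr([0,1])}P_I(\nu).$$ **Functional $P_I$.** For $\nu\in\Pr([0,1])$ let $\phi_\nu:[0,1]\times\mathbb R\to\mathbb R$ be the unique weak solution (continuous, with essentially bounded weak spatial derivative, equation in the distributional sense) of $\partial_t\phi_\nu+\frac{\xi''(t)}2(\partial_x^2\phi_\nu+\nu([0,t])(\partial_x\phi_\nu)^2)=0$, $\phi_\nu(1,x)=\log\cosh x$; then $P_I(\nu)=\phi_\nu(0,h)-\frac12\int_0^1\xi''(s)s\,\nu([0,s])ds$. **Functional $P$.** For $q\in[-1,1]$, $\mathcal Q_q$ is the set of continuous, weakly differentiable ($W^{1,1}$), non-decreasing (in the positive semidefinite order) paths $Q_t=(q_{ij}(t))_{i,j\le 2}$, $t\in[0,1]$, of $2\times2$ positive semidefinite matrices with $Q_0=0$ and $Q_1=\begin{pmatrix}1 & q \\ q & 1\end{pmatrix}$. Put $A(t)=\xi''(Q_t)\odot\dot Q_t$ ($\odot$ is the entrywise product, $\xi''$ applied entrywise). For $\lambda\in\mathbb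 R$ let $u$ be the weak solution on $[0,1]\times\mathbb R^2$ of $$\partial_tu+\tfrac12\big(\langle A,D^2u\rangle+\nu([0,t])\langle Du,A\,Du\rangle\big)=0,\qquad u(1,x)=\log\Big(\tfrac14\sum_{\epsilon_1,\epsilon_2\in\{\pm1\}}e^{\epsilon_1x_1+\epsilon_2x_2+\lambda\epsilon_1\epsilon_2}\Big)$$ (for degenerate $A$, $u$ is understood by continuous extension, i.e. as the limit $\delta\downarrow0$ of the solutions with $A+\delta\,\mathrm{Id}$). Then $$P(\nu,Q,\lambda)=u(0,(h,h))-\lambda q-\tfrac12\sum_{i,j}\int_0^1\nu([0,t])\,\xi''(q_{ij}(t))\,q_{ij}(t)\,\dot q_{ij}(t)\,dt .$$ *)

(* Defs.v *)
From HB Require Import structures.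
From mathcomp Require Import all_boot all_order all_algebra.
From mathcomp Require Import all_classical all_reals all_analysis.
Import Order.TTheory GRing.Theory Num.Theory.
Import numFieldNormedType.Exports.

Set Implicit Arguments.
Unset Strict Implicit.
Unset Printing Implicit Defensive.

Local Open Scope classical_set_scope.
Local Open Scope ring_scope.

Definition spin (R : realType) (b : bool) : R := (-1) ^+ b.

Definition config (N : nat) := {ffun 'I_N -> bool}.

Definition magnetization (R : realType) (N : nat) (s : config N) : R :=
  \sum_(i < N) spin R (s i).

Definition overlap (R : realType) (N : nat) (s1 s2 : config N) : R :=
  N%:R^-1 * \sum_(i < N) spin R (s1 i) * spin R (s2 i).

(* beta 0 is unused: the sum runs over p >= 1. *)
Definition xi_term (R : realType) (beta : nat -> R) (t : R) (p : nat) : R :=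
  beta p.+1 ^+ 2 * t ^+ p.+1.

Definition xi (R : realType) (beta : nat -> R) (t : R) : R :=
  limn (series (xi_term beta t)).

(* Mean m and standard deviation s; s = 0 is the degenerate Gaussian, which
   normal_prob does not cover. *)
Definition gaussian_law (R : realType) (m s : R) : set R -> \bar R :=
  if s == 0 then dirac m else normal_prob m s.

Definition gaussian_process (R : realType) (d : measure_display)
    (Omega : measurableType d) (P : probability Omega R) (S : finType)
    (X : S -> {RV P >-> R}) : Prop :=
  forall a : S -> R, exists m s : R, forall B : set R, measurable B ->
    P [set w | B (\sum_(x : S) a x * X x w)] = gaussian_law m s B.

Definition hamiltonian (R : realType) (d : measure_display)
    (Omega : measurableType d) (P : probability Omega R)
    (beta : nat -> R) (h : R) (N : nat) (H : config N -> {RV P >-> R}) : Prop :=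
  [/\ gaussian_process H,
      forall s, ('E_P[H s])%E = (h * magnetization R s)%:E
    & forall s1 s2, covariance P (H s1) (H s2)
        = (N%:R * xi beta (overlap R s1 s2))%:E].

Definition uniform_weight (R : realType) (N : nat) : R :=
  #|{: config N}|%:R^-1.

Definition partition_function (R : realType) (N : nat)
    (H : config N -> R) : R :=
  \sum_(s : config N) uniform_weight R N * expR (- H s).

Definition gibbs (R : realType) (N : nat) (H : config N -> R)
    (s : config N) : R :=
  uniform_weight R N * expR (- H s) / partition_function H.

Definition overlap_law (R : realType) (N : nat) (H : config N -> R)
    (B : set R) : R :=
  \sum_(s : config N * config N | overlap R s.1 s.2 \in B)
     gibbs H s.1 * gibbs H s.2.

Section dynamics.
Variables (R : realType) (S : finType).

Definition markov_matrix (Q : S -> S -> R) : Prop :=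
  (forall x y, 0 <= Q x y) /\ (forall x, \sum_(y : S) Q x y = 1).

Definition detailed_balance (pi : S -> R) (Q : S -> S -> R) : Prop :=
  forall x y, pi x * Q x y = pi y * Q y x.

Definition inner (pi f g : S -> R) : R := \sum_(x : S) pi x * f x * g x.

Definition variance_wrt (pi f : S -> R) : R :=
  inner pi f f - (inner pi f (cst 1)) ^+ 2.

Definition generator (Q : S -> S -> R) (f : S -> R) : S -> R :=
  fun x => f x - \sum_(y : S) Q x y * f y.

Definition spectral_gap (pi : S -> R) (Q : S -> S -> R) : \bar R :=
  ereal_inf [set (inner pi (generator Q f) f / variance_wrt pi f)%:E
            | f in [set f : S -> R | variance_wrt pi f != 0]].

End dynamics.

Definition nearest_neighbor (R : realType) (N : nat)
    (Q : config N -> config N -> R) : Prop :=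
  forall x y : config N, (1 < #|[pred i | x i != y i]|)%N -> Q x y = 0.

Definition rate_function (R : realType) (D : set R) (I : R -> \bar R) : Prop :=
  (forall q, D q -> (0 <= I q)%E) /\
  (forall c : R, closed [set q | D q /\ (I q <= c%:E)%E]).

(* Speed N; lne is the extended logarithm, with lne 0 = -oo. *)
Definition large_deviation_principle (R : realType) (D : set R)
    (mu : nat -> set R -> R) (I : R -> \bar R) : Prop :=
  [/\ rate_function D I,
      forall F, closed F ->
        (limn_esup (fun N => N%:R^-1%:E * lne (mu N (F `&` D))%:E)
          <= - ereal_inf (I @` (F `&` D)))%E
    & forall G, open G ->
        (- ereal_inf (I @` (G `&` D))
          <= limn_einf (fun N => N%:R^-1%:E * lne (mu N (G `&` D))%:E))%E].

Section distributions.
Variable R : realType.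

(* Iterated directional derivatives of order at most k exist and are
   continuous; for finite-dimensional V this is the class C^k. *)
Fixpoint Ck (V : normedModType R) (k : nat) (f : V -> R) : Prop :=
  continuous f /\
  if k is k'.+1 then
    forall v : V, (forall x, derivable f x v) /\ Ck k' ('D_v f)
  else True.

Definition test_function (V : normedModType R) (U : set V) (f : V -> R) : Prop :=
  let K := closure [set x | f x != 0] in
  [/\ (forall k, Ck k f), compact K & K `<=` U].

Definition weak_derivative (f g : R -> R) : Prop :=
  lebesgue_measure.-integrable `]0, 1[%classic (EFin \o g) /\
  forall eta : R -> R, test_function (V := R^o) `]0, 1[%classic eta ->
    \int[lebesgue_measure]_(t in `]0, 1[) (f t * eta^`()%classic t) =
    - \int[lebesgue_measure]_(t in `]0, 1[) (g t * eta t).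

Definition wderiv (f : R -> R) : R -> R := xget (cst 0) (weak_derivative f).

Definition on01 (nu : probability (measurableTypeR R) R) : Prop :=
  nu `[0, 1]%classic = 1%E.

Definition cdf01 (nu : probability (measurableTypeR R) R) (t : R) : R :=
  fine (nu `[0, t]%classic).

Definition ess_bounded d (T : measurableType d) (mu : set T -> \bar R)
    (D : set T) (g : T -> R) : Prop :=
  measurable_fun D g /\
  exists M : R, \forall z \ae mu, D z -> `|g z| <= M.

End distributions.

Local Notation lebesgue2 := (lebesgue_measure \x lebesgue_measure)%E.
(* Left-associated: the library's \x takes a sigma-finite right factor. *)
Local Notation lebesgue3 := (lebesgue2 \x lebesgue_measure)%E.

Section parisi_one_replica.
Variables (R : realType) (beta : nat -> R) (h : R).

Let xi2 : R -> R := (xi beta : R -> R^o)^`(2)%classic.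

Definition log_cosh (x : R) : R := ln ((expR x + expR (- x)) / 2).

(* Space-time points are pairs (t, x). *)
Definition strip1 : set (R * R)%type := [set z | 0 < z.1 < 1].
Definition closed_strip1 : set (R * R)%type := [set z | 0 <= z.1 <= 1].

Definition weak_solution1 (nu : probability (measurableTypeR R) R)
    (u : R * R -> R) : Prop :=
  [/\ {within closed_strip1, continuous u},
      forall x, u (1, x) = log_cosh x
    & exists du : R * R -> R,
      [/\ ess_bounded lebesgue2 strip1 du,
          forall eta, test_function strip1 eta ->
            \int[lebesgue2]_(z in strip1) (u z * 'D_(0, 1) eta z) =
            - \int[lebesgue2]_(z in strip1) (du z * eta z)
        & forall eta, test_function strip1 eta ->
            \int[lebesgue2]_(z in strip1)
              (- (u z * 'D_(1, 0) eta z)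
               + xi2 z.1 / 2 *
                 (u z * 'D_(0, 1) ('D_(0, 1) eta) z
                  + cdf01 nu z.1 * du z ^+ 2 * eta z)) = 0]].

(* The weak solution is unique; xget selects it. *)
Definition phi (nu : probability (measurableTypeR R) R) : R * R -> R :=
  xget (cst 0) (weak_solution1 nu).

Definition P_I (nu : probability (measurableTypeR R) R) : R :=
  phi nu (0, h) - 2^-1 *
    \int[lebesgue_measure]_(s in `[0, 1]) (xi2 s * s * cdf01 nu s).

End parisi_one_replica.

Section parisi_two_replicas.
Variables (R : realType) (beta : nat -> R) (h : R).

Let xi2 : R -> R := (xi beta : R -> R^o)^`(2)%classic.

Definition psd (M : 'M[R]_2) : Prop :=
  M^T = M /\ forall x : 'rV[R]_2, 0 <= (x *m M *m x^T) 0 0.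

Definition endpoint (q : R) : 'M[R]_2 :=
  \matrix_(i, j) (if i == j then 1 else q).

(* Only the restriction of Q to [0, 1] is meaningful. *)
Definition overlap_path (q : R) (Q : R -> 'M[R]_2) : Prop :=
  [/\ forall i j, {within `[0, 1], continuous (fun t => Q t i j)},
      forall i j, exists g, weak_derivative (fun t => Q t i j) g,
      forall t, 0 <= t <= 1 -> psd (Q t),
      forall s t, 0 <= s -> s <= t -> t <= 1 -> psd (Q t - Q s)
    & Q 0 = 0 /\ Q 1 = endpoint q].

Definition dot (Q : R -> 'M[R]_2) (t : R) : 'M[R]_2 :=
  \matrix_(i, j) wderiv (fun s => Q s i j) t.

Definition diffusion (Q : R -> 'M[R]_2) (t : R) : 'M[R]_2 :=
  \matrix_(i, j) (xi2 (Q t i j) * dot Q t i j).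

Definition terminal2 (lambda x1 x2 : R) : R :=
  ln (4^-1 * \sum_(e1 : bool) \sum_(e2 : bool)
        expR (spin R e1 * x1 + spin R e2 * x2
              + lambda * spin R e1 * spin R e2)).

(* Space-time points are triples (t, x1, x2). *)
Definition strip2 : set (R * R * R)%type := [set z | 0 < z.1.1 < 1].
Definition closed_strip2 : set (R * R * R)%type := [set z | 0 <= z.1.1 <= 1].

Definition e_ (i : 'I_2) : R * R * R :=
  if i == 0 then (0, 1, 0) else (0, 0, 1).

Definition weak_solution2 (nu : probability (measurableTypeR R) R)
    (A : R -> 'M[R]_2) (lambda : R) (u : R * R * R -> R) : Prop :=
  [/\ {within closed_strip2, continuous u},
      forall x1 x2, u (1, x1, x2) = terminal2 lambda x1 x2
    & exists du : 'I_2 -> R * R * R -> R,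
      [/\ forall i, ess_bounded lebesgue3 strip2 (du i),
          forall i eta, test_function strip2 eta ->
            \int[lebesgue3]_(z in strip2) (u z * 'D_(e_ i) eta z) =
            - \int[lebesgue3]_(z in strip2) (du i z * eta z)
        & forall eta, test_function strip2 eta ->
            \int[lebesgue3]_(z in strip2)
              (- (u z * 'D_(1, 0, 0) eta z)
               + 2^-1 * \sum_(i < 2) \sum_(j < 2) A z.1.1 i j *
                 (u z * 'D_(e_ i) ('D_(e_ j) eta) z
                  + cdf01 nu z.1.1 * du i z * du j z * eta z)) = 0]].

Definition solution2 (nu : probability (measurableTypeR R) R)
    (A : R -> 'M[R]_2) (lambda : R) : R * R * R -> R :=
  xget (cst 0) (weak_solution2 nu A lambda).

Definition uniformly_elliptic (A : R -> 'M[R]_2) : Prop :=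
  exists2 c : R, 0 < c &
    \forall t \ae lebesgue_measure, 0 < t < 1 -> psd (A t - c%:M).

(* Degenerate diffusions are understood by vanishing viscosity. *)
Definition solution2_ext (nu : probability (measurableTypeR R) R)
    (A : R -> 'M[R]_2) (lambda : R) (z : R * R * R) : R :=
  if `[< uniformly_elliptic A >] then solution2 nu A lambda z
  else lim (solution2 nu (fun t => A t + delta%:M) lambda z
            @[delta --> 0^'+]).

Definition P_two (nu : probability (measurableTypeR R) R)
    (Q : R -> 'M[R]_2) (lambda q : R) : R :=
  solution2_ext nu (diffusion Q) lambda (0, h, h) - lambda * q
  - 2^-1 * \sum_(i < 2) \sum_(j < 2)
      \int[lebesgue_measure]_(t in `[0, 1])
        (cdf01 nu t * xi2 (Q t i j) * Q t i j * dot Q t i j).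

Definition overlap_rate (q : R) : \bar R :=
  (- ereal_inf [set p | exists lambda Q nu,
        [/\ overlap_path q Q, on01 nu & p = (P_two nu Q lambda q)%:E]]
   + 2%:E * ereal_inf [set (P_I beta h nu)%:E | nu in [set nu | on01 nu]])%E.

End parisi_two_replicas.

(* An undefined -oo + +oo evaluates to -oo, so that such triples do not
   contribute to the supremum. *)
Definition barrier (R : realType) (I : R -> \bar R) : \bar R :=
  ereal_sup [set x | exists q1 q2 q3 : R,
    [/\ -1 <= q1, q1 < q2, q2 < q3, q3 <= 1
      & x = (- I q1 + I q2 - I q3)%E]].

Definition generalized_FEB (R : realType) (I : R -> \bar R) : Prop :=
  (0 < barrier I)%E.

(* Main.v *)
(* Fix q1 < q2 < q3 and test the Poincare inequality on the indicator of
   {R_12 < q2}, viewed as a function of two replicas.  Its variance is at least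
   the product of the overlap masses left and right of q2, while its Dirichlet
   form is carried by the pairs from which one move crosses level q2; a move
   changes the overlap by at most 2/N, so these pairs have overlap within 2/N of
   q2.  The large deviation principle evaluates the three masses as
   exp (- N I) at q1, q3 and q2 up to subexponential factors, lower
   semicontinuity of I allowing the window around q2 to be shrunk. *)
Require Import Defs.
From HB Require Import structures.
From mathcomp Require Import all_boot all_order all_algebra.
From mathcomp Require Import all_classical all_reals all_analysis.
From mathcomp Require Import lra.
Import Order.TTheory GRing.Theory Num.Theory.
Import numFieldNormedType.Exports.

Local Open Scope classical_set_scope.
Local Open Scope ring_scope.

(** * Conductance bounds from the spectral gap *)

Section cheeger.
Variables (R : realType) (S : finType) (mu : S -> R) (Q : S -> S -> R).
Hypotheses (mu_ge0 : forall x, 0 <= mu x) (mu_sum1 : \sum_x mu x = 1).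
Hypothesis Q_markov : markov_matrix Q.

Let gen_indicator (A : pred S) x :
  generator Q (fun x => (A x)%:R) x * (A x)%:R
  = (A x)%:R * \sum_(y | ~~ A y) Q x y.
Proof.
rewrite /generator; case: (A x); rewrite ?mulr0 ?mul0r // mulr1 mul1r.
rewrite -{1}(Q_markov.2 x) -sumrB [RHS]big_mkcond; apply: eq_bigr => y _ /=.
by case: (A y); rewrite ?mulr1 ?mulr0 ?subrr ?subr0.
Qed.

(** The indicator of [A] is the test function: its Dirichlet form is the one-step flow out of [A],
    and its variance is the mass of [A] times that of the complement. *)
Lemma indicator_poincare (A : pred S) (l : R) : 0 <= l ->
    (l%:E <= spectral_gap mu Q)%E ->
  l * ((\sum_(x | A x) mu x) * \sum_(x | ~~ A x) mu x)
    <= \sum_(x | A x) mu x * \sum_(y | ~~ A y) Q x y.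
Proof.
move=> l0 lgap; set f := fun x => (A x)%:R : R.
have fE : inner mu (generator Q f) f
    = \sum_(x | A x) mu x * \sum_(y | ~~ A y) Q x y.
  rewrite /inner [RHS]big_mkcond; apply: eq_bigr => x _.
  by rewrite -mulrA gen_indicator; case: (A x); rewrite ?mul1r // mul0r mulr0.
have sumA : \sum_x mu x * f x = \sum_(x | A x) mu x.
  rewrite [RHS]big_mkcond; apply: eq_bigr => x _.
  by rewrite /f; case: (A x); rewrite ?mulr1 ?mulr0.
have vE : variance_wrt mu f
    = (\sum_(x | A x) mu x) * \sum_(x | ~~ A x) mu x.
  have -> : \sum_(x | ~~ A x) mu x = 1 - \sum_(x | A x) mu x.
    by rewrite -mu_sum1 [in RHS](bigID A) /= addrAC subrr add0r.
  rewrite mulrBr mulr1 -expr2 /variance_wrt -sumA; congr (_ - _ ^+ 2).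
    by apply: eq_bigr => x _; rewrite /f; case: (A x); rewrite ?mulr1 ?mulr0.
  by apply: eq_bigr => x _; rewrite mulr1.
(* With zero variance the indicator is not admissible in the infimum, but then the left side
   vanishes and the flow is nonnegative. *)
rewrite -fE -vE; have [v0|v0] := eqVneq (variance_wrt mu f) 0.
  rewrite v0 mulr0 fE sumr_ge0 // => x _; rewrite mulr_ge0 // sumr_ge0 // => y _.
  exact: Q_markov.1.
have vgt0 : 0 < variance_wrt mu f.
  by rewrite lt0r v0 vE mulr_ge0 // sumr_ge0.
rewrite -ler_pdivlMr // -lee_fin (le_trans lgap) //.
by apply: ereal_inf_lbound; exists f.
Qed.

(* Replacing the two replicas one at a time reduces the variance of a function
   on the product space to those of its slices; the symmetry of [A] makes the
   two contributions equal, whence the factor 2. *)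
Lemma two_replica_cheeger (A : rel S) (l : R) : 0 <= l ->
    (l%:E <= spectral_gap mu Q)%E -> symmetric A ->
  l * ((\sum_(s : S * S | A s.1 s.2) mu s.1 * mu s.2)
       * \sum_(s : S * S | ~~ A s.1 s.2) mu s.1 * mu s.2)
    <= 2 * \sum_(s : S * S | A s.1 s.2
             && [exists y, ~~ A y s.2 && (Q s.1 y != 0)]) mu s.1 * mu s.2.
Proof.
move=> l0 lgap symA.
(* [V z] is the variance of the indicator of the slice [A ^~ z]. *)
pose V z := (\sum_(x | A x z) mu x) * \sum_(y | ~~ A y z) mu y.
have VE z : V z = \sum_x \sum_y mu x * mu y * (A x z && ~~ A y z)%:R.
  rewrite /V big_distrl big_mkcond; apply: eq_bigr => x _ /=.
  case: (A x z) => /=; last by rewrite big1 // => y _; rewrite mulr0.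
  rewrite big_distrr big_mkcond; apply: eq_bigr => y _ /=.
  by case: (A y z); rewrite ?mulr1 ?mulr0.
have step1 : (\sum_(s : S * S | A s.1 s.2) mu s.1 * mu s.2)
       * (\sum_(s : S * S | ~~ A s.1 s.2) mu s.1 * mu s.2)
    <= 2 * \sum_z mu z * V z.
  rewrite big_mkcond [X in _ * X]big_mkcond /=.
  rewrite -(pair_bigA _ (fun x z => if A x z then mu x * mu z else 0)) /=.
  rewrite -(pair_bigA _ (fun x z => if ~~ A x z then mu x * mu z else 0)) /=.
  (* Weight of two independent pairs [(x, z)] and [(y, t)]. *)
  pose W x z y t := mu x * mu z * (mu y * mu t).
  have -> : (\sum_x \sum_z (if A x z then mu x * mu z else 0))
        * (\sum_y \sum_t (if ~~ A y t then mu y * mu t else 0))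
      = \sum_x \sum_z \sum_y \sum_t W x z y t * (A x z && ~~ A y t)%:R.
    rewrite big_distrl; apply: eq_bigr => x _; rewrite big_distrl.
    apply: eq_bigr => z _; rewrite big_distrr; apply: eq_bigr => y _.
    rewrite big_distrr; apply: eq_bigr => t _ /=.
    by rewrite /W; case: (A x z); case: (A y t);
      rewrite /= ?mulr1 ?mulr0 ?mul0r.
  have E1 : \sum_x \sum_z \sum_y \sum_t W x z y t * (A x z && ~~ A y z)%:R
      = \sum_z mu z * V z.
    rewrite exchange_big; apply: eq_bigr => z _; rewrite VE big_distrr.
    apply: eq_bigr => x _; rewrite big_distrr; apply: eq_bigr => y _ /=.
    rewrite -big_distrl /= /W -big_distrr /= -big_distrr /= mu_sum1.
    by rewrite mulr1 [mu x * _]mulrC -!mulrA.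
  have E2 : \sum_x \sum_z \sum_y \sum_t W x z y t * (A y z && ~~ A y t)%:R
      = \sum_z mu z * V z.
    under eq_bigr do rewrite exchange_big.
    rewrite exchange_big; apply: eq_bigr => y _ /=.
    rewrite VE big_distrr exchange_big; apply: eq_bigr => z _ /=.
    rewrite exchange_big big_distrr; apply: eq_bigr => t _ /=.
    rewrite -big_distrl /= /W -!big_distrl /= mu_sum1 mul1r.
    rewrite (symA y z) (symA y t).
    by rewrite !mulrA [mu y * _]mulrC.
  (* On the way from [(x, z)] to [(y, t)] through [(y, z)], the relation must be lost at one of the
     two replacements. *)
  rewrite mulr_natl mulr2n -{1}E1 -E2 -big_split ler_sum // => x _.
  rewrite -big_split ler_sum // => z _.
  rewrite -big_split ler_sum // => y _.
  rewrite -big_split ler_sum // => t _ /=.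
  rewrite -mulrDr ler_wpM2l //; first by rewrite /W !mulr_ge0.
  by rewrite -natrD ler_nat; case: (A x z); case: (A y z); case: (A y t).
apply: le_trans (ler_wpM2l l0 step1) _.
rewrite mulrCA ler_wpM2l // big_distrr [leRHS]big_mkcond /=.
rewrite -(pair_bigA _ (fun x z =>
  if A x z && [exists y, ~~ A y z && (Q x y != 0)]
  then mu x * mu z else 0)) /=.
rewrite [leRHS]exchange_big ler_sum // => z _.
rewrite mulrCA.
have zgap := indicator_poincare (A ^~ z) l l0 lgap.
apply: le_trans (ler_wpM2l (mu_ge0 z) zgap) _.
rewrite big_distrr big_mkcond ler_sum // => x _ /=.
case: (A x z) => //=; rewrite mulrCA mulrA -[leRHS]mulr1.
(* The exit probability is at most 1, and it is 0 when no permitted move leaves the slice. *)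
case: ifPn => [_|/existsPn Qx0].
  rewrite ler_wpM2l ?mulr_ge0 // -(Q_markov.2 x).
  rewrite [leRHS](bigID (fun y => ~~ A y z)) /= lerDl sumr_ge0 // => y _.
  exact: Q_markov.1.
rewrite big1 ?mulr0 ?mul0r // => y nAy.
by apply/eqP; move: (Qx0 y); rewrite nAy negbK.
Qed.

End cheeger.

(** * Overlaps, single spin flips and Gibbs masses *)

Section overlap_cut.
Variables (R : realType) (N : nat).

Lemma overlapC : commutative (@overlap R N).
Proof.
by move=> s t; congr (_ * _); apply: eq_bigr => i _; rewrite mulrC.
Qed.

Lemma norm_spin b : `|spin R b| = 1.
Proof. by rewrite normrX normrN1 expr1n. Qed.

Lemma norm_overlap_le1 (s t : config N) : `|overlap R s t| <= 1.
Proof.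
rewrite normrM ger0_norm ?invr_ge0 //.
(* For [N = 0] the inverse of 0 is 0 by convention, so the overlap is 0. *)
have [N0|N0] := posnP N.
  have iN0 : N%:R^-1 = 0 :> R by rewrite N0 invr0.
  by rewrite iN0 mul0r.
rewrite ler_pdivrMl ?ltr0n // mulr1 (le_trans (ler_norm_sum _ _ _)) //.
rewrite (eq_bigr (fun=> 1)) ?sumr_const ?card_ord // => i _.
by rewrite normrM !norm_spin mulr1.
Qed.

(** At most one coordinate contributes to the difference, and its term has size at most 2. *)
Lemma overlap_nearest_neighbor (x y z : config N) :
  (#|[pred i | x i != y i]| <= 1)%N ->
  `|overlap R x z - overlap R y z| <= 2 / N%:R.
Proof.
move=> xy; rewrite /overlap -mulrBr -sumrB normrM ger0_norm ?invr_ge0 //.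
rewrite mulrC ler_wpM2r ?invr_ge0 // (le_trans (ler_norm_sum _ _ _)) //.
rewrite (bigID [pred i | x i != y i]) /= [X in _ + X]big1 => [|i].
  rewrite addr0 (@le_trans _ _ (\sum_(i | x i != y i) 2)) //.
    apply: ler_sum => i _; rewrite (le_trans (ler_normB _ _)) //.
    by rewrite !normrM !norm_spin mulr1.
  by rewrite sumr_const -[leRHS]mulr1n ler_wpMn2l.
by rewrite negbK => /eqP ->; rewrite subrr normr0.
Qed.

Lemma partition_function_gt0 (E : config N -> R) : 0 < partition_function E.
Proof.
have c0 : (0 < #|{: config N}|)%N by apply/card_gt0P; exists [ffun=> true].
have w0 s : 0 < uniform_weight R N * expR (- E s).
  by rewrite mulr_gt0 ?expR_gt0 // invr_gt0 ltr0n.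
rewrite /partition_function (bigD1 [ffun=> true]) //=.
by rewrite ltr_wpDr // sumr_ge0 // => s _; apply: ltW.
Qed.

Lemma gibbs_ge0 (E : config N -> R) s : 0 <= gibbs E s.
Proof.
by rewrite /gibbs !mulr_ge0 ?invr_ge0 ?expR_ge0 // ltW // partition_function_gt0.
Qed.

Lemma gibbs_sum1 (E : config N -> R) : \sum_s gibbs E s = 1.
Proof. by rewrite -mulr_suml divff // gt_eqF // partition_function_gt0. Qed.

(** The cut is [overlap R x y < q]. The masses on the left are those of traces of open sets and the
    window on the right is closed, to fit the lower and upper bounds of the large deviation
    principle. *)
Lemma overlap_law_gap (E : config N -> R) (Q : config N -> config N -> R)
    (q eta l : R) :
    markov_matrix Q -> nearest_neighbor Q -> 2 / N%:R <= eta ->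
    0 <= l -> (l%:E <= spectral_gap (gibbs E) Q)%E ->
  l * (overlap_law E ([set t | t < q] `&` `[-1, 1])
       * overlap_law E ([set t | t > q] `&` `[-1, 1]))
    <= 2 * overlap_law E (`[q - eta, q + eta] `&` `[-1, 1]).
Proof.
move=> mQ nQ hN l0 lgap.
pose A (x y : config N) := overlap R x y < q.
have law_mono (B C : pred (config N * config N)) : (forall s, B s -> C s) ->
    \sum_(s | B s) gibbs E s.1 * gibbs E s.2
      <= \sum_(s | C s) gibbs E s.1 * gibbs E s.2.
  move=> BC; rewrite big_mkcond [leRHS]big_mkcond ler_sum // => s _.
  have := BC s; case: (B s) => [->//|_].
  by case: ifP => // _; rewrite mulr_ge0 // gibbs_ge0.
have law0 B : 0 <= overlap_law E B.
  by rewrite sumr_ge0 // => s _; rewrite mulr_ge0 // gibbs_ge0.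
apply: le_trans (_ : _ <= l * ((\sum_(s | A s.1 s.2) gibbs E s.1 * gibbs E s.2)
       * \sum_(s | ~~ A s.1 s.2) gibbs E s.1 * gibbs E s.2)) _.
  rewrite ler_wpM2l // ler_pM //; apply: law_mono => s; rewrite inE => -[] //=.
  by rewrite /A -leNgt => /ltW.
apply: le_trans (two_replica_cheeger _ _ _ _ (gibbs_ge0 E) (gibbs_sum1 E) mQ
  A l l0 lgap _) _; first by move=> x y; rewrite /A overlapC.
rewrite ler_wpM2l // law_mono // => -[x z] /= /andP[Axz /existsP[y]].
(* [Q x y != 0] allows at most one flip, so [overlap R x z] lies below [q], [overlap R y z] does
   not, and they differ by at most [eta]. *)
case/andP=> nA Qxy; have xy : (#|[pred i | x i != y i]| <= 1)%N.
  by rewrite leqNgt; apply: contra Qxy => /nQ ->.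
have := overlap_nearest_neighbor x y z xy.
have := norm_overlap_le1 x z.
rewrite inE /= !in_itv /= !ler_norml => /andP[-> ->] /andP[h1 h2].
by move: Axz nA; rewrite /A -leNgt => Axz nA; split=> //; lra.
Qed.

End overlap_cut.

(** * Logarithmic scale and eventual bounds *)

Section limits.
Variable R : realType.
Local Open Scope ereal_scope.

(** Every extended real [x] is covered: for [x <= 0] the logarithm is [-oo] and both sides hold, for
    [x = +oo] both fail. *)
Lemma scaled_lne_le (N : nat) (x : \bar R) (c : R) : (0 < N)%N ->
  (N%:R^-1%:E * lne x <= c%:E) = (x <= (expR (c * N%:R))%:E).
Proof.
move=> N0; have iN : (0 < N%:R^-1 :> R)%R by rewrite invr_gt0 ltr0n.
have loN : N%:R^-1%:E * -oo = -oo :> \bar R by rewrite gt0_muleNy ?lte_fin.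
case: x => [r||] /=; last by rewrite loN !leNye.
- case: ifPn => [r0|]; first by
    rewrite loN leNye lee_fin (le_trans r0) // expR_ge0.
  rewrite -ltNge => r0; rewrite !lee_fin mulrC ler_pdivrMr ?ltr0n //.
  by rewrite -{1}(expRK (c * N%:R)%R) ler_ln // posrE expR_gt0.
- by rewrite gt0_muley ?lte_fin // !leye_eq.
Qed.

Lemma lt_scaled_lne (N : nat) (x : \bar R) (c : R) : (0 < N)%N ->
  (c%:E < N%:R^-1%:E * lne x) = ((expR (c * N%:R))%:E < x).
Proof. by move=> N0; rewrite !ltNge scaled_lne_le. Qed.

Lemma limn_esup_lt_near (u : (\bar R)^nat) (a : \bar R) :
  limn_esup u < a -> \forall n \near \oo, u n < a.
Proof.
rewrite /limn_esup limf_esupE => /ereal_inf_lt[_ [V FV <-]] supV.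
apply: filterS FV => n Vn; apply: le_lt_trans supV.
by apply: ereal_sup_ubound; exists n.
Qed.

Lemma limn_einf_gt_near (u : (\bar R)^nat) (a : \bar R) :
  a < limn_einf u -> \forall n \near \oo, a < u n.
Proof.
rewrite /limn_einf lteNr => /limn_esup_lt_near; apply: filterS => n.
by rewrite lteN2.
Qed.

Lemma limn_esup_le_near (u : (\bar R)^nat) (a : \bar R) :
  (\forall n \near \oo, u n <= a) -> limn_esup u <= a.
Proof.
move=> ua; rewrite /limn_esup limf_esupE.
apply: (@le_trans _ _ (ereal_sup [set u n | n in [set n | u n <= a]])).
  by apply: ereal_inf_lbound; exists [set n | u n <= a].
by apply: ge_ereal_sup => _ [n un <-].
Qed.
End limits.

(** * Exponential rate of the gap *)

Section gap_rate.
Variable R : realType.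

Lemma lte_real_between (a b : \bar R) : (a < b)%E ->
  exists2 r : R, (a < r%:E)%E & (r%:E < b)%E.
Proof.
case: a => [x||]; case: b => [y||] //.
- by rewrite lte_fin => xy; exists ((x + y) / 2); rewrite lte_fin; lra.
- by move=> _; exists (x + 1); rewrite ?ltry // lte_fin ltrDl.
- by move=> _; exists (y - 1); rewrite ?ltNyr // lte_fin; lra.
- by move=> _; exists 0; rewrite ?ltry ?ltNyr.
Qed.

(** An infinite [a] or [c] would make the combination [-oo], so both are finite; [b] may be [+oo],
    hence the real [t] below it that still leaves slack. *)
Lemma lt_ereal_barrier (a b c : \bar R) (r : R) : (0 <= a -> 0 <= c ->
    r%:E < - a + b - c ->
  exists x y t : R, [/\ a = x%:E, c = y%:E, (r + x + y < t)%R & t%:E < b])%E.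
Proof.
case: a => [x||] // _.
case: c => [y||] // _; last by rewrite /= addeNy ltNge leNye.
case: b => [z||] //=.
- rewrite -!EFinD lte_fin => rz.
  exists x, y, ((r + x + y + z) / 2).
  by split=> //; rewrite ?lte_fin; lra.
- move=> _; exists x, y, (r + x + y + 1); split=> //; last exact: ltry.
  by rewrite ltrDl.
Qed.

(** The sublevel set of [I] at level [t] is closed and misses [q], hence misses a ball around [q];
    half its radius gives a closed window inside it. *)
Lemma rate_function_near (D : set R) (I : R -> \bar R) (q t : R) :
    rate_function D I -> D q -> (t%:E < I q)%E ->
  exists2 eta : R, 0 < eta &
    (t%:E <= ereal_inf (I @` (`[(q - eta)%R, (q + eta)%R] `&` D)))%E.
Proof.
move=> [_ /(_ t) closedI] Dq tI.
have : nbhs q (~` [set q | D q /\ (I q <= t%:E)%E]).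
  apply: open_nbhs_nbhs; split; first exact: closed_openC.
  by move=> [_]; rewrite leNgt tI.
move=> /nbhs_ballP[e /= e0 Be]; exists (e / 2); first by rewrite divr_gt0.
apply: le_ereal_inf_tmp => _ [p [/= pq Dp] <-].
rewrite leNgt; apply/negP => /ltW Ip; apply: (Be p) => //.
move: pq; rewrite in_itv /= => /andP[h1 h2].
by rewrite /ball /= ltr_norml; apply/andP; split; lra.
Qed.

(** One realization of the disorder is fixed here, so the argument is deterministic. *)
Lemma gap_rate_le (E : forall N, config N -> R)
    (Q : forall N, config N -> config N -> R) (I : R -> \bar R) :
    large_deviation_principle `[-1, 1]%classic
      (fun N => overlap_law (E N)) I ->
    (forall N, (0 < N)%N -> markov_matrix (Q N)) ->
    (forall N, (0 < N)%N -> nearest_neighbor (Q N)) ->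
  (limn_esup (fun N => N%:R^-1%:E * lne (spectral_gap (gibbs (E N)) (Q N)))
    <= - barrier I)%E.
Proof.
move=> [rI ldF ldG] mQ nQ; rewrite leeNr; apply: ge_ereal_sup.
move=> _ [q1 [q2 [q3 [q1ge q12 q23 q3le ->]]]].
have inD q : (-1 <= q <= 1) -> `[-1, 1]%classic q by rewrite /= in_itv.
have [D1 D2 D3] : [/\ `[-1, 1]%classic q1, `[-1, 1]%classic q2
    & `[-1, 1]%classic q3] by split; apply: inD; lra.
rewrite leNgt; apply/negP => gapI.
have [r gapr rI'] := lte_real_between _ _ gapI.
have [x [y [t [Ix Iy rt tI]]]] :=
  lt_ereal_barrier _ _ _ _ (rI.1 _ D1) (rI.1 _ D3) rI'.
have [eta eta0 infK] := rate_function_near _ _ _ _ rI D2 tI.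
(* The slack has five shares: one for each of the three masses and two for the factor 2 of the
   conductance bound. *)
have [eps eps0 epsE] : exists2 eps : R, 0 < eps & 5 * eps = t - (r + x + y).
  by exists ((t - (r + x + y)) / 5); lra.
have closedK : closed `[q2 - eta, q2 + eta]%classic by exact: itv_closed.
have nearK : \forall N \near \oo, (N%:R^-1%:E *
    lne (overlap_law (E N) (`[q2 - eta, q2 + eta] `&` `[-1, 1]))%:E
    < (- t + eps)%:E)%E.
  apply: limn_esup_lt_near; apply: le_lt_trans (ldF _ closedK) _.
  by apply: (@le_lt_trans _ _ (- t%:E)%E); rewrite ?leeN2 // lte_fin; lra.
have near_open q z (G : set R) : open G -> G q -> `[-1, 1]%classic q ->
    I q = z%:E -> \forall N \near \oo, ((- z - eps)%:E < N%:R^-1%:E *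
      lne (overlap_law (E N) (G `&` `[-1, 1]))%:E)%E.
  move=> oG Gq Dq Iq; apply: limn_einf_gt_near.
  apply: lt_le_trans (ldG _ oG); apply: (@lt_le_trans _ _ (- I q)%E).
    by rewrite Iq lte_fin; lra.
  by rewrite leeN2; apply: ereal_inf_lbound; exists q.
have nearL := near_open q1 x _ (@open_lt _ q2) q12 D1 Ix.
have nearU := near_open q3 y _ (@open_gt _ q2) q23 D3 Iy.
(* The choice of [r] is contradicted once the gap is eventually at most [expR (- r * N%:R)]. *)
move: gapr; rewrite lteNl ltNge => /negP; apply.
apply: limn_esup_le_near.
near=> N.
have N0 : (0 < N)%N by near: N; exact: nbhs_infty_gt.
have Neta : 2 / N%:R <= eta.
  rewrite ler_pdivrMr ?ltr0n // -ler_pdivrMl // mulrC.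
  by near: N; exact: nbhs_infty_ger.
(* Since [1 + x <= expR x], this gives [2 <= expR (2 * eps * N%:R)]. *)
have Neps : 2 <= 2 * eps * N%:R.
  rewrite -ler_pdivrMl ?mulr_gt0 // mulrC.
  by near: N; exact: nbhs_infty_ger.
(* If the gap exceeded [expR (- r * N%:R)], this number could serve as [l] in [overlap_law_gap]; the
   three mass bounds exclude that. *)
rewrite -EFinN scaled_lne_le // leNgt; apply/negP => /ltW gapN.
have := overlap_law_gap _ _ _ _ q2 _ _ (mQ _ N0) (nQ _ N0) Neta
  (expR_ge0 _) gapN.
apply/negP; rewrite -ltNge.
have : (N%:R^-1%:E *
    lne (overlap_law (E N) (`[q2 - eta, q2 + eta] `&` `[-1, 1]))%:E
    < (- t + eps)%:E)%E by near: N.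
move=> /ltW; rewrite scaled_lne_le // lee_fin => hK.
have : ((- x - eps)%:E < N%:R^-1%:E *
  lne (overlap_law (E N) ([set p : R | p < q2] `&` `[-1, 1]))%:E)%E by near: N.
rewrite lt_scaled_lne // lte_fin => hL.
have : ((- y - eps)%:E < N%:R^-1%:E *
  lne (overlap_law (E N) ([set p : R | p > q2] `&` `[-1, 1]))%:E)%E by near: N.
rewrite lt_scaled_lne // lte_fin => hU.
apply: (@le_lt_trans _ _ (2 * expR ((- t + eps) * N%:R))).
  by rewrite ler_wpM2l.
apply: (@le_lt_trans _ _ (expR (- r * N%:R) * (expR ((- x - eps) * N%:R) *
    expR ((- y - eps) * N%:R)))).
  have e2 : (2 <= expR (2 * eps * N%:R)).
    by apply: le_trans (expR_ge1Dx _); lra.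
  apply: le_trans (ler_wpM2r (expR_ge0 _) e2) _.
  rewrite -!expRD ler_expR -!mulrDl ler_wpM2r //.
  by lra.
rewrite ltr_pM2l ?expR_gt0 //.
by rewrite ltr_pM // expR_ge0.
Unshelve. all: by end_near.
Qed.
End gap_rate.

Theorem theorem1p16 (R : realType) (d : measure_display)
    (Omega : measurableType d) (P : probability Omega R)
    (beta : nat -> R) (h : R)
    (hbeta : exists2 eps : R, 0 < eps &
       cvgn (series (xi_term beta (1 + eps))))
    (hh : 0 <= h)
    (hconvex : convex_function (`[-1, 1]%classic : set R^o)
       (xi beta : R^o -> R^o))
    (H : forall N : nat, config N -> {RV P >-> R})
    (hH : forall N : nat, (0 < N)%N -> hamiltonian beta h (H N))
    (I : R -> \bar R)
    (hLDP : {ae P, forall w : Omega,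
       large_deviation_principle `[-1, 1]%classic
         (fun N => overlap_law (fun s => H N s w)) I})
    (hI : forall q : R, -1 <= q <= 1 -> I q = overlap_rate beta h q)
    (Q : forall N : nat, config N -> config N -> {RV P >-> R})
    (hmarkov : forall N : nat, (0 < N)%N -> {ae P, forall w : Omega,
       markov_matrix (fun x y => Q N x y w)})
    (hnn : forall N : nat, (0 < N)%N -> {ae P, forall w : Omega,
       nearest_neighbor (fun x y => Q N x y w)})
    (hbalance : forall N : nat, (0 < N)%N -> {ae P, forall w : Omega,
       detailed_balance (gibbs (fun s => H N s w))
         (fun x y => Q N x y w)}) :
  let rate (w : Omega) : \bar R :=
    limn_esup (fun N => N%:R^-1%:E *
      lne (spectral_gap (gibbs (fun s => H N s w)) (fun x y => Q N x y w)))%E in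
  {ae P, forall w : Omega, (rate w <= - barrier I)%E} /\
  (generalized_FEB I -> {ae P, forall w : Omega, (rate w < 0)%E}).
Proof.
move=> rate.
have gapI : {ae P, forall w, (rate w <= - barrier I)%E}.
  (* Countably many null sets are discarded, so that one [w] serves every [N]. *)
  have mQ : {ae P, forall w N, (0 < N)%N ->
      markov_matrix (fun x y => Q N x y w)}.
    apply: ae_foralln => N; case: (posnP N) => [->|N0]; first exact: aeW.
    by apply: filterS (hmarkov N N0) => w.
  have nQ : {ae P, forall w N, (0 < N)%N ->
      nearest_neighbor (fun x y => Q N x y w)}.
    apply: ae_foralln => N; case: (posnP N) => [->|N0]; first exact: aeW.
    by apply: filterS (hnn N N0) => w.
  apply: filterS3 hLDP mQ nQ => w ldp mQ nQ.
  exact: (gap_rate_le _ (fun N s => H N s w) (fun N x y => Q N x y w) I).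
split=> // FEB; apply: filterS gapI => w /le_lt_trans; apply.
by rewrite oppe_lt0.
Qed.
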